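(* Let $\zeta_{i,j}=U(\kappa^i\xi^j)$ for $i,j\ge0$. Then for any $i\ge 2$ and $j\ge 0$, $$\zeta_{i,j}=(10\xi^3-40\xi^4+32\xi^5)\,\zeta_{i-1,j}-\xi^5\,\zeta_{i-2,j},$$ and for any $i\ge 0$ and $j\ge 2$, $$\zeta_{i,j}=(10\xi-8\xi^2)\,\zeta_{i,j-1}-(9\xi-8\xi^2)\,\zeta_{i,j-2}.$$
   Context: Let $E(q)=\prod_{m\ge1}(1-q^m)$. Define $$\gamma(q)=\frac{E(q)^5E(q^2)^5E(q^6)^5}{E(q^3)^{15}},\qquad \xi=\xi(q)=\frac{E(q^2)^5E(q^6)}{E(q)E(q^3)^5},\qquad \kappa=\kappa(q)=\frac{\gamma(q^2)^2}{\gamma(q)}.$$ $U$ is the operator on power series given by $U\left(\sum_n a_nq^n\right)=\sum_n a_{2n}q^n$. All identities are identities of formal power series in $q$. *)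

(* Defs.v *)
From HB Require Import structures.
From mathcomp Require Import all_boot all_order all_algebra.
Set Implicit Arguments. Unset Strict Implicit. Unset Printing Implicit Defensive.
Import Order.TTheory GRing.Theory Num.Theory.
Local Open Scope ring_scope.

Definition fps := nat -> rat.

Definition fconst (c : rat) : fps := fun n => if n == 0%N then c else 0.
Definition fone : fps := fconst 1.
Definition fadd (a b : fps) : fps := fun n => a n + b n.
Definition fsub (a b : fps) : fps := fun n => a n - b n.
Definition fscale (c : rat) (a : fps) : fps := fun n => c * a n.
Definition fmul (a b : fps) : fps := fun n => \sum_(k < n.+1) a k * b (n - k)%N.
Definition fexp (a : fps) (k : nat) : fps := iter k (fmul a) fone.

(* Multiplicative inverse (for a 0 <> 0): b_0 = 1/a_0,
   b_n = -(1/a_0) * sum_{k=1}^n a_k b_{n-k}.  finv_aux a n = [:: b_0; ...; b_n]. *)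
Fixpoint finv_aux (a : fps) (n : nat) : seq rat :=
  match n with
  | 0%N => [:: (a 0%N)^-1]
  | m.+1 => let s := finv_aux a m in
      rcons s (- (a 0%N)^-1 *
               \sum_(k < m.+1) a k.+1 * nth 0 s (m - k)%N)
  end.
Definition finv (a : fps) : fps := fun n => nth 0 (finv_aux a n) n.

Definition fdil (k : nat) (a : fps) : fps :=
  fun n => if (k %| n)%N then a (n %/ k)%N else 0.

Definition U (a : fps) : fps := fun n => a (2 * n)%N.

(* E(q) = prod_{m>=1} (1 - q^m); its n-th coefficient equals that of the
   finite product over 1 <= m <= n. *)
Definition E : fps :=
  fun n => (\prod_(m < n) (1 - 'X^(m.+1)) : {poly rat})`_n.

Definition Ek (k : nat) : fps := fdil k E.

Definition gamma : fps :=
  fmul (fmul (fmul (fexp (Ek 1) 5) (fexp (Ek 2) 5)) (fexp (Ek 6) 5))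
       (finv (fexp (Ek 3) 15)).

Definition xi : fps :=
  fmul (fmul (fexp (Ek 2) 5) (Ek 6)) (finv (fmul (Ek 1) (fexp (Ek 3) 5))).

Definition kappa : fps := fmul (fexp (fdil 2 gamma) 2) (finv gamma).

Definition zeta (i j : nat) : fps := U (fmul (fexp kappa i) (fexp xi j)).

(* Main.v *)
(** Write q for the variable, E_k = E(q^k), y = xi(q^2), and
    r = q E_2^2 E_12^4 / (E_4^4 E_6^2). Two eta-quotient identities give
    kappa = (1 - r)^(-5) and y = 1 / (1 - r^2); the second one, read in q instead
    of q^2, gives xi = 1 + r (1 - r) / (1 + r)^2. Hence kappa and xi are roots of
    quadratics whose coefficients are polynomials in y = xi(q^2), and U(f(q^2) g)
    = f U(g) turns these into the two recurrences.

    Both eta-quotient identities are instances, in base q^12, of Weierstrass'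
    three-term relation. By the Jacobi triple product (obtained from the
    q-binomial theorem), theta(x + z) theta(x - z) is a double sum which the change
    of variables (m, n) -> (m + n - 1, m - n) brings to the form
    O(x) V(z) - V(x) O(z), so the three-term relation is a Pluecker relation. *)
From HB Require Import structures.
From mathcomp Require Import all_boot all_order all_algebra.
From mathcomp Require Import boolp.
From mathcomp Require Import zify ring.
Require Import Defs.
Set Implicit Arguments. Unset Strict Implicit. Unset Printing Implicit Defensive.
Import Order.TTheory GRing.Theory Num.Theory.
Local Open Scope ring_scope.

(** * Formal power series form an integral domain *)

Definition trunc (N : nat) (a : fps) : {poly rat} := \poly_(i < N) a i.

Lemma coef_trunc N (a : fps) i : (i < N)%N -> (trunc N a)`_i = a i.
Proof. by move=> iN; rewrite coef_poly iN. Qed.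

Lemma fmul_trunc N (a b : fps) n : (n < N)%N ->
  fmul a b n = (trunc N a * trunc N b)`_n.
Proof.
move=> nN; rewrite coefM; apply: eq_bigr => i _.
by rewrite !coef_trunc //; have := ltn_ord i; lia.
Qed.

Lemma fmulC : commutative fmul.
Proof. by move=> a b; apply/funext => n; rewrite !(@fmul_trunc n.+1) // mulrC. Qed.

(** Coefficient [n] of a product sees only coefficients up to [n] of the factors, so associativity
    descends from polynomials through truncation. *)
Lemma fmulA : associative fmul.
Proof.
move=> a b c; apply/funext => n.
have e1 (u v w : {poly rat}) : (forall i, (i < n.+1)%N -> v`_i = w`_i) ->
    (u * v)`_n = (u * w)`_n.
  by move=> vw; rewrite !coefM; apply: eq_bigr => i _; rewrite vw //; lia.
have e2 u v i : (i < n.+1)%N ->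
    (trunc n.+1 (fmul u v))`_i = (trunc n.+1 u * trunc n.+1 v)`_i.
  by move=> iN; rewrite coef_trunc // (@fmul_trunc n.+1).
rewrite !(@fmul_trunc n.+1) // (e1 _ _ _ (e2 b c)) mulrA.
by rewrite [in RHS]mulrC (e1 _ _ _ (e2 a b)) mulrC.
Qed.

Lemma fmul1 : left_id fone fmul.
Proof.
move=> a; apply/funext => n; rewrite /fmul big_ord_recl subn0 mul1r.
by rewrite big1 ?addr0 // => i _; rewrite /fone /fconst mul0r.
Qed.

Lemma fmulDl : left_distributive fmul fadd.
Proof.
move=> a b c; apply/funext => n; rewrite /fmul /fadd -big_split.
by apply: eq_bigr => i _; rewrite mulrDl.
Qed.

HB.instance Definition _ := gen_eqMixin fps.
HB.instance Definition _ := gen_choiceMixin fps.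

Lemma faddA : associative fadd.
Proof. by move=> a b c; apply/funext => n; rewrite /fadd addrA. Qed.
Lemma faddC : commutative fadd.
Proof. by move=> a b; apply/funext => n; rewrite /fadd addrC. Qed.
Lemma fadd0 : left_id (fconst 0) fadd.
Proof. by move=> a; apply/funext => n; rewrite /fadd /fconst if_same add0r. Qed.
Lemma faddN : left_inverse (fconst 0) (fscale (-1)) fadd.
Proof.
by move=> a; apply/funext => n; rewrite /fadd /fconst if_same /fscale mulN1r addNr.
Qed.

HB.instance Definition _ := GRing.isZmodule.Build fps faddA faddC fadd0 faddN.

Lemma fone_neq0 : fone != 0 :> fps.
Proof. by apply/eqP => /(congr1 (fun a : fps => a 0%N)) /eqP. Qed.

HB.instance Definition _ :=
  GRing.Zmodule_isComNzRing.Build fps fmulA fmulC fmul1 fmulDl fone_neq0.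

Definition funit : pred fps := fun a => a 0%N != 0.
(** The value outside the units follows the convention of the unit ring structure. *)
Definition finvr (a : fps) : fps := if funit a then finv a else a.

Lemma size_finv_aux a n : size (finv_aux a n) = n.+1.
Proof. by elim: n => //= n IH; rewrite size_rcons IH. Qed.

Lemma nth_finv_aux a n i : (i <= n)%N -> nth 0 (finv_aux a n) i = finv a i.
Proof.
elim: n => [|n IH]; first by rewrite leqn0 => /eqP->.
rewrite leq_eqVlt => /orP[/eqP-> //|lein].
by rewrite /= nth_rcons size_finv_aux lein IH.
Qed.

Lemma finvS a n :
  finv a n.+1 = - (a 0%N)^-1 * \sum_(k < n.+1) a k.+1 * finv a (n - k)%N.
Proof.
rewrite /finv /= nth_rcons size_finv_aux ltnn eqxx; congr (_ * _).
by apply: eq_bigr => i _; rewrite nth_finv_aux // leq_subr.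
Qed.

Lemma fmulV a : funit a -> fmul (finvr a) a = fone.
Proof.
rewrite /finvr => ua; rewrite ua fmulC; apply/funext => -[|n].
  by rewrite /fmul big_ord1 mulfV.
rewrite /fmul big_ord_recl subn0 finvS mulrA mulrN mulfV // mulN1r.
by apply/eqP; rewrite addrC subr_eq0; apply/eqP; apply: eq_bigr.
Qed.

Lemma funitP (a b : fps) : fmul b a = fone -> funit a.
Proof.
move=> /(congr1 (fun a : fps => a 0%N)); rewrite /fmul big_ord1 /funit => ba.
by apply/eqP => a0; move: ba; rewrite a0 mulr0.
Qed.

Lemma finvr_out (a : fps) : ~~ funit a -> finvr a = a.
Proof. by rewrite /finvr => /negPf->. Qed.

HB.instance Definition _ :=
  GRing.ComNzRing_hasMulInverse.Build fps fmulV funitP finvr_out.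

(** If [ca] and [cb] are the orders of two nonzero factors, the only nonzero term of coefficient
    [ca + cb] of the product is the product of the two leading coefficients. Integrality is what
    gives access to a fraction field. *)
Lemma fmul_integral (a b : fps) : a * b = 0 -> (a == 0) || (b == 0).
Proof.
move=> ab; case: (eqVneq a 0) => //= /eqP a0; apply/eqP; apply: contrapT => b0.
have nz (c : fps) : c <> 0 -> exists n, c n != 0.
  move=> c0; apply: contrapT => nc; apply: c0; apply/funext => n.
  rewrite [RHS]if_same; apply/eqP; apply: contrapT => cn; apply: nc.
  by exists n; apply/negP.
have [ca ha la] := ex_minnP (nz _ a0); have [cb hb lb] := ex_minnP (nz _ b0).
have := congr1 (fun c : fps => c (ca + cb)%N) ab.
rewrite [RHS]if_same => /eqP; apply/negP.
have ltc : (ca < (ca + cb).+1)%N by lia.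
rewrite [X in X != 0](bigD1 (Ordinal ltc)) //= big1 ?addr0.
  by rewrite addKn mulf_neq0.
move=> i /eqP ni; have {}ni : (i : nat) <> ca.
  by move=> ei; apply: ni; apply/val_inj.
case: (ltnP i ca) => ic.
  by case: (eqVneq (a i) 0) => [->|/la]; [rewrite mul0r | lia].
case: (eqVneq (b (ca + cb - i)%N) 0) => [->|/lb]; first by rewrite mulr0.
by have := ltn_ord i; lia.
Qed.

HB.instance Definition _ := GRing.ComUnitRing_isIntegral.Build fps fmul_integral.

(** * Congruences, dilations and infinite products *)

Lemma fps0E n : (0 : fps) n = 0. Proof. exact: if_same. Qed.
Lemma fpsDE (a b : fps) n : (a + b) n = a n + b n. Proof. by []. Qed.
Lemma fpsNE (a : fps) n : (- a) n = - a n. Proof. exact: mulN1r. Qed.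

Definition of_poly (p : {poly rat}) : fps := fun n => p`_n.

Lemma of_poly_is_additive : {morph of_poly : x y / x - y >-> x - y}.
Proof. by move=> x y; apply/funext => n; rewrite fpsDE fpsNE /of_poly coefB. Qed.
Lemma of_poly_is_monoid_morphism : monoid_morphism of_poly.
Proof.
split; last by move=> x y; apply/funext => n; rewrite /of_poly coefM.
by apply/funext => n; rewrite /of_poly coef1; case: n.
Qed.
HB.instance Definition _ :=
  GRing.isZmodMorphism.Build {poly rat} fps of_poly of_poly_is_additive.
HB.instance Definition _ :=
  GRing.isMonoidMorphism.Build {poly rat} fps of_poly of_poly_is_monoid_morphism.

Definition fpsX : fps := of_poly 'X.

Lemma fpsXnE e n : (fpsX ^+ e) n = (n == e)%:R.
Proof. by rewrite -(rmorphXn of_poly) [LHS]coefXn. Qed.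

(** Congruence modulo q^N: infinite products and bilateral sums are handled only through finite
    approximations modulo every q^N. *)
Definition eqm N (a b : fps) := forall n, (n < N)%N -> a n = b n.

Lemma eqm_refl N a : eqm N a a. Proof. by []. Qed.
Lemma eqm_sym N a b : eqm N a b -> eqm N b a.
Proof. by move=> ab n nN; rewrite ab. Qed.
Lemma eqm_trans N b a c : eqm N a b -> eqm N b c -> eqm N a c.
Proof. by move=> ab bc n nN; rewrite ab // bc. Qed.
Lemma eqmD N a b c d : eqm N a b -> eqm N c d -> eqm N (a + c) (b + d).
Proof. by move=> ab cd n nN; rewrite !fpsDE ab // cd. Qed.
Lemma eqmN N a b : eqm N a b -> eqm N (- a) (- b).
Proof. by move=> ab n nN; rewrite !fpsNE ab. Qed.
Lemma eqmB N a b c d : eqm N a b -> eqm N c d -> eqm N (a - c) (b - d).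
Proof. by move=> ab /eqmN; apply: eqmD. Qed.
Lemma eqmM N a b c d : eqm N a b -> eqm N c d -> eqm N (a * c) (b * d).
Proof.
move=> ab cd n nN; apply: eq_bigr => i _; have := ltn_ord i => iN.
by rewrite ab ?cd //; lia.
Qed.
Lemma eqm_sum N I (r : seq I) (P : pred I) (F G : I -> fps) :
  (forall i, P i -> eqm N (F i) (G i)) ->
  eqm N (\sum_(i <- r | P i) F i) (\sum_(i <- r | P i) G i).
Proof. by move=> FG; apply: big_ind2 => // *; apply: eqmD. Qed.
Lemma eqm_prod N I (r : seq I) (P : pred I) (F G : I -> fps) :
  (forall i, P i -> eqm N (F i) (G i)) ->
  eqm N (\prod_(i <- r | P i) F i) (\prod_(i <- r | P i) G i).
Proof. by move=> FG; apply: big_ind2 => // *; apply: eqmM. Qed.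
Lemma eqmP a b : (forall N, eqm N a b) -> a = b.
Proof. by move=> ab; apply/funext => n; apply: (ab n.+1). Qed.
Lemma eqm_Xn0 N e a : (N <= e)%N -> eqm N (fpsX ^+ e * a) 0.
Proof.
move=> Ne n nN; rewrite fps0E; apply: big1 => i _.
by rewrite fpsXnE; case: eqP => [ie|]; [have := ltn_ord i; lia | rewrite mul0r].
Qed.

Lemma fpsX_neq0 : fpsX != 0.
Proof.
apply/eqP => /(congr1 (fun a : fps => a 1%N)).
by rewrite fps0E /fpsX /of_poly coefX.
Qed.

Lemma fdil_comp k N (a : fps) n : (0 < k)%N -> (n < N)%N ->
  fdil k a n = (trunc N a \Po 'X^k)`_n.
Proof.
move=> k0 nN; rewrite coef_comp_poly_Xn // /fdil; case: ifP => // _.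
by rewrite coef_trunc //; apply: leq_ltn_trans nN; apply: leq_div.
Qed.

Lemma fdilB k : {morph fdil k : a b / a - b >-> a - b}.
Proof.
move=> a b; apply/funext => n; rewrite fpsDE fpsNE /fdil.
by case: ifP; rewrite ?subr0 // fpsDE fpsNE.
Qed.

Lemma fdil1 k : (0 < k)%N -> fdil k 1 = 1.
Proof.
move=> k0; apply/funext => n; rewrite (@fdil_comp _ n.+1) //.
have ->: trunc n.+1 1 = 1.
  apply/polyP => -[|i]; rewrite coef_poly coef1 //=.
  by case: ifP.
by rewrite comp_polyC coefC /=.
Qed.

(** At multiples of [k] this is multiplicativity of composition with X^k on truncations. Elsewhere
    both sides vanish, since [k] cannot divide both [i] and [n - i]. *)
Lemma fdilM k : (0 < k)%N -> {morph fdil k : a b / a * b >-> a * b}.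
Proof.
move=> k0 a b; apply/funext => n.
rewrite [RHS](@fmul_trunc n.+1) // /fdil; case: ifP => [/dvdnP[m ->]|kn].
  rewrite mulnK //.
  have mN : (m < (m * k).+1)%N by rewrite ltnS leq_pmulr.
  transitivity (((trunc (m*k).+1 a * trunc (m*k).+1 b) \Po 'X^k)`_(m * k)).
    by rewrite coef_comp_poly_Xn // dvdn_mull // mulnK // -(fmul_trunc _ _ mN).
  rewrite comp_polyM !coefM; apply: eq_bigr => i _.
  by rewrite -!fdil_comp ?coef_trunc //; have := ltn_ord i; lia.
rewrite coefM big1 // => i _; rewrite !coef_trunc //; last by have := ltn_ord i; lia.
rewrite /fdil; case: ifP => ki; last by rewrite mul0r.
case: ifP => kni; last by rewrite mulr0.
have le_in : (i <= n)%N by rewrite -ltnS.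
by have := dvdn_add ki kni; rewrite subnKC // kn.
Qed.
Lemma fdilXn k a m : (0 < k)%N -> fdil k (a ^+ m) = fdil k a ^+ m.
Proof. by move=> k0; elim: m => [|m IH]; rewrite ?fdil1 // !exprS fdilM // IH. Qed.
Lemma fdil_prod k I (r : seq I) (F : I -> fps) : (0 < k)%N ->
  fdil k (\prod_(i <- r) F i) = \prod_(i <- r) fdil k (F i).
Proof. by move=> k0; apply: (big_morph _ (fdilM k0) (fdil1 k0)). Qed.
Lemma fdilX k : (0 < k)%N -> fdil k fpsX = fpsX ^+ k.
Proof.
move=> k0; apply/funext => n; rewrite fpsXnE /fdil /fpsX /of_poly coefX.
case: ifP => [/dvdnP[m ->]|kn]; first by rewrite mulnK // -{2}[k]mul1n eqn_pmul2r.
by case: eqP => // nk; rewrite nk dvdnn in kn.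
Qed.
Lemma fdil_eqm k N a b : (0 < k)%N -> eqm N a b -> eqm N (fdil k a) (fdil k b).
Proof.
move=> k0 ab n nN; rewrite /fdil; case: ifP => // _; apply: ab.
by apply: leq_ltn_trans nN; apply: leq_div.
Qed.
Lemma fdil_comp_mul k l a : (0 < k)%N -> (0 < l)%N -> fdil k (fdil l a) = fdil (k * l) a.
Proof.
move=> k0 l0; apply/funext => n; rewrite /fdil; case: ifP => [/dvdnP[m ->]|kn].
  by rewrite mulnK // (mulnC m) dvdn_pmul2l // divnMl.
by case: ifP => // kl; rewrite (dvdn_trans (dvdn_mulr l (dvdnn k)) kl) in kn.
Qed.
Lemma fdil_inj k : (0 < k)%N -> injective (fdil k).
Proof.
move=> k0 a b ab; apply/funext => n.
by have := congr1 (fun c : fps => c (n * k)%N) ab; rewrite /fdil dvdn_mull // mulnK.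
Qed.

(** The infinite product (q^b; q^a) over all i >= 0. For positive [a] and [b], the factors with i >=
    n differ from 1 only beyond degree [n], so [n] factors determine coefficient [n]. *)
Definition qprod (a b : nat) : fps :=
  fun n => (\prod_(i < n) (1 - fpsX ^+ (a * i + b))) n.

Lemma qprod_eqm a b N M : (0 < a)%N -> (0 < b)%N -> (N <= M)%N ->
  eqm N (qprod a b) (\prod_(i < M) (1 - fpsX ^+ (a * i + b))).
Proof.
move=> a0 b0 NM n nN; rewrite /qprod.
have {NM nN} : (n <= M)%N by lia.
elim: M => [|M IH]; first by rewrite leqn0 => /eqP->.
rewrite leq_eqVlt => /orP[/eqP-> //|]; rewrite ltnS => nM.
rewrite (IH nM) big_ord_recr /=.
set A := \prod_(_ < _) _.
have := @eqmB n.+1 (A * 1) (A * 1) _ _ (@eqm_refl _ _)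
  (@eqm_Xn0 n.+1 (a * M + b) A _).
rewrite mulr1 subr0 mulrBr mulr1 (mulrC A) => ->//; nia.
Qed.

Lemma E_qprod : E = qprod 1 1.
Proof.
apply/funext => n; rewrite /E /qprod.
rewrite -[LHS]/(of_poly _ n) rmorph_prod; apply: (congr1 (fun a : fps => a n)).
by apply: eq_bigr => i _; rewrite rmorphB rmorph1 rmorphXn /= mul1n addn1.
Qed.

Lemma fdil_qprod k a b : (0 < k)%N -> (0 < a)%N -> (0 < b)%N ->
  fdil k (qprod a b) = qprod (k * a) (k * b).
Proof.
move=> k0 a0 b0; apply: eqmP => N.
have ka0 : (0 < k * a)%N by rewrite muln_gt0 k0.
have kb0 : (0 < k * b)%N by rewrite muln_gt0 k0.
apply: eqm_trans (fdil_eqm k0 (qprod_eqm a0 b0 (leqnn N))) _.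
apply: eqm_sym; apply: eqm_trans (qprod_eqm ka0 kb0 (leqnn N)) _.
rewrite fdil_prod //; apply: eqm_prod => i _.
by rewrite fdilB fdil1 // fdilXn // fdilX // -exprM mulnDr mulnA.
Qed.

Lemma Ek_qprod k : (0 < k)%N -> Ek k = qprod k k.
Proof. by move=> k0; rewrite /Ek E_qprod fdil_qprod // muln1. Qed.

Lemma prod_ord_mul (R : comPzRingType) (F : nat -> R) s N :
  \prod_(i < s * N) F i = \prod_(r < s) \prod_(i < N) F (s * i + r)%N.
Proof.
elim: N => [|N IH].
  by rewrite muln0 big_ord0 big1 // => r _; rewrite big_ord0.
under [RHS]eq_bigr do rewrite big_ord_recr /=.
rewrite big_split /= -IH mulnS addnC big_split_ord /=; congr (_ * _).
Qed.

(** The factors are sorted by the residue of their index modulo [s]; this brings all the E_k with k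
    dividing 12 to the common base q^12. *)
Lemma qprod_split s a b : (0 < s)%N -> (0 < a)%N -> (0 < b)%N ->
  qprod a b = \prod_(r < s) qprod (s * a) (a * r + b).
Proof.
move=> s0 a0 b0; apply: eqmP => N.
have Nle : (N <= s * N)%N by rewrite leq_pmull.
apply: eqm_trans (qprod_eqm a0 b0 Nle) _; apply: eqm_sym.
rewrite (@prod_ord_mul _ (fun i => 1 - fpsX ^+ (a * i + b))).
apply: eqm_prod => r _.
have sa0 : (0 < s * a)%N by rewrite muln_gt0 s0.
have arb : (0 < a * r + b)%N by lia.
apply: eqm_trans (qprod_eqm sa0 arb (leqnn N)) _.
apply: eqm_prod => i _; suff -> : (s * a * i + (a * r + b) = a * (s * i + r) + b)%N by [].
by ring.
Qed.

Lemma qprod0 a b : qprod a b 0%N = 1.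
Proof. by rewrite /qprod big_ord0. Qed.

Lemma neq0_coef0 (a : fps) : a 0%N != 0 -> a != 0.
Proof. by apply: contraNneq => ->; rewrite fps0E. Qed.

Lemma finvK (a : fps) : a 0%N != 0 -> finv a * a = 1.
Proof. by move=> a0; rewrite -[RHS](fmulV a0) /finvr /funit a0. Qed.

Lemma fexpE (a : fps) k : fexp a k = a ^+ k.
Proof. by elim: k => // k IH; rewrite exprS -IH. Qed.

(** * The Jacobi triple product *)

(** Gaussian binomial coefficient, by a q-Pascal rule. The truncated [m' - k'] is harmless: for m' <
    k' it multiplies a zero coefficient. *)
Fixpoint qbin (R : comPzRingType) (p : R) (m k : nat) : R :=
  match m, k with
  | _, 0%N => 1
  | 0%N, _.+1 => 0
  | m'.+1, k'.+1 => qbin p m' k'.+1 + p ^+ (m' - k') * qbin p m' k'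
  end.

Lemma qbin0 (R : comPzRingType) (p : R) m : qbin p m 0 = 1.
Proof. by case: m. Qed.

Lemma qbin_small (R : comPzRingType) (p : R) m k : (m < k)%N -> qbin p m k = 0.
Proof.
elim: m k => [|m IH] [|k] //=; rewrite ltnS => mk.
by rewrite !IH ?mulr0 ?addr0 //; lia.
Qed.

(** The q-binomial theorem, kept homogeneous in [a] and [b] so that the triple product needs no
    negative powers of q. Induction: the last factor splits the sum in two, and the q-Pascal rule
    recombines the halves. *)
Lemma qbinomial (R : comPzRingType) (p a b : R) m :
  \prod_(i < m) (a + b * p ^+ i) =
  \sum_(k < m.+1) qbin p m k * p ^+ 'C(k, 2) * a ^+ (m - k) * b ^+ k.
Proof.
elim: m => [|m IH]; first by rewrite big_ord0 big_ord1 /= !expr0 !mulr1.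
rewrite big_ord_recr /= IH mulrDr [RHS]big_ord_recl /=.
pose t k := qbin p m k * p ^+ 'C(k, 2) * a ^+ (m.+1 - k) * b ^+ k.
transitivity (\sum_(k < m.+2) t k +
    \sum_(i < m.+1) p ^+ (m - i) * qbin p m i * p ^+ 'C(i.+1, 2) *
      a ^+ (m - i) * b ^+ i.+1).
  congr (_ + _).
    rewrite [RHS]big_ord_recr /=.
    have -> : t m.+1 = 0 by rewrite /t qbin_small // !mul0r.
    rewrite addr0 big_distrl /=.
    apply: eq_bigr => i _; rewrite /t subSn; last by have := ltn_ord i; lia.
    by rewrite exprS; ring.
  rewrite big_distrl /=; apply: eq_bigr => i _.
  have im : (i <= m)%N by have := ltn_ord i; lia.
  have -> : p ^+ m = p ^+ (m - i) * p ^+ i by rewrite -exprD subnK.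
  by rewrite binS bin1 exprD exprS; ring.
rewrite big_ord_recl -addrA /t /= qbin0; congr (_ + _).
rewrite -big_split /=; apply: eq_bigr => i _.
by rewrite /bump /= add1n subSS; ring.
Qed.

Definition qfact (R : comPzRingType) (p : R) n := \prod_(i < n) (1 - p ^+ i.+1).

(** The factorial formula without division. The induction rests on (1 - p^(m-k)) + p^(m-k) (1 -
    p^(k+1)) = 1 - p^(m+1). *)
Lemma qbin_qfact (R : comPzRingType) (p : R) m k : (k <= m)%N ->
  qbin p m k * qfact p k * qfact p (m - k) = qfact p m.
Proof.
have qfact0 : qfact p 0 = 1 by rewrite /qfact big_ord0.
have qfactS n : qfact p n.+1 = qfact p n * (1 - p ^+ n.+1).
  by rewrite /qfact big_ord_recr.
elim: m k => [|m IH] [|k] km; rewrite ?qbin0 ?qfact0 ?subn0 ?mul1r //.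
have h1 := IH k km; rewrite subSS /=.
have h2 : qbin p m k.+1 * qfact p k.+1 * qfact p (m - k) =
          qfact p m * (1 - p ^+ (m - k)).
  move: km; rewrite ltnS leq_eqVlt => /orP[/eqP ->|km].
    by rewrite qbin_small // subnn expr0 subrr !mul0r mulr0.
  rewrite -(IH _ km); have -> : (m - k = (m - k.+1).+1)%N by lia.
  by rewrite (qfactS (m - k.+1)%N) mulrA.
transitivity (qbin p m k.+1 * qfact p k.+1 * qfact p (m - k) +
   p ^+ (m - k) * (1 - p ^+ k.+1) * (qbin p m k * qfact p k * qfact p (m - k))).
  by rewrite qfactS; ring.
rewrite h2 h1 qfactS.
have -> : p ^+ m.+1 = p ^+ (m - k) * p ^+ k.+1.
  by rewrite -exprD; congr (_ ^+ _); lia.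
by ring.
Qed.

Definition ints (n : nat) : seq int := [seq i%:Z - n%:Z | i <- iota 0 (2 * n).+1].

Lemma mem_ints n (k : int) : (k \in ints n) = (`|k| <= n)%N.
Proof.
apply/mapP/idP => [[i]|kn]; first by rewrite mem_iota => ? ->; lia.
by exists (absz (k + n%:Z)); rewrite ?mem_iota; lia.
Qed.

Lemma ints_uniq n : uniq (ints n).
Proof. by rewrite map_inj_uniq ?iota_uniq // => i j; lia. Qed.

(* The absolute value only serves to land in [nat]: see [jexpE]. *)
Definition jexp (j : nat) (k : int) : nat := `|6 * k * k - 6 * k + j%:Z * k|.

(** This both removes the absolute value from [jexp] and makes the terms with |k| >= N vanish modulo
    q^N. *)
Lemma jexp_bound j (k : int) : (0 < j < 12)%N ->
  `|k| <= 6 * k * k - 6 * k + j%:Z * k.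
Proof.
move=> /andP[j0 j12]; have [k0|k0] := lerP 0 k.
  have [->|k1] : k = 0 \/ 1 <= k by lia.
    by rewrite !mulr0.
  have : 0 <= k * (k - 1) by apply: mulr_ge0; lia.
  have : 0 <= k * (j%:Z - 1) by apply: mulr_ge0; lia.
  lia.
have : 0 <= (- k) * (- k - 1) by apply: mulr_ge0; lia.
have : 0 <= (- k) * (11 - j%:Z) by apply: mulr_ge0; lia.
lia.
Qed.

Lemma jexpE j k : (0 < j < 12)%N -> (jexp j k)%:Z = 6 * k * k - 6 * k + j%:Z * k.
Proof. by move=> /(jexp_bound k); rewrite /jexp; lia. Qed.

Lemma jexp_ge j k : (0 < j < 12)%N -> (`|k| <= jexp j k)%N.
Proof. by move=> jb; have := jexp_bound k jb; rewrite -(jexpE k jb); lia. Qed.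

Lemma bin2_double k : (2 * 'C(k, 2) + k = k * k)%N.
Proof. by elim: k => // k IH; rewrite binS bin1; lia. Qed.

(** The q-binomial theorem in base q^12 is applied to the product of q^(12n) - q^(j + 12i) over i <
    2n. Its lower half yields the factors with 12 - j, its upper half those with j, and the
    summation index is recentred by [n]. *)
Lemma finite_triple_product j n : (0 < j < 12)%N ->
  (\prod_(i < n) (1 - fpsX ^+ (12 * i + j))) *
  (\prod_(i < n) (1 - fpsX ^+ (12 * i + (12 - j)))) =
  \sum_(k <- ints n)
    (-1) ^+ `|k|%N * qbin (fpsX ^+ 12) (2 * n) (absz (k + n%:Z)) * fpsX ^+ jexp j k.
Proof.
move=> jb; have /andP[j0 j12] := jb.
pose D := (\sum_(i < n) (12 * i + j) + 12 * n * n)%N.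
have DE : (D + 6 * n = 18 * n * n + j * n)%N.
  rewrite /D; elim: n {D} => [|n IH]; first by rewrite big_ord0; lia.
  rewrite big_ord_recr /=; move: IH; move: (\sum_(_ < n) _)%N => S. lia.
have D0 : (-1) ^+ n * fpsX ^+ D != 0 
  by rewrite mulf_neq0 // expf_neq0 ?oppr_eq0 ?oner_eq0 ?fpsX_neq0.
apply: (mulfI D0).
have powE (x : fps) : x ^+ n = \prod_(i < n) x by rewrite prodr_const card_ord.
transitivity (\prod_(i < n + n) (fpsX ^+ (12 * n) + (- fpsX ^+ j) * (fpsX ^+ 12) ^+ i)).
  have low : \prod_(i < n) (fpsX ^+ (12 * n) + (- fpsX ^+ j) * (fpsX ^+ 12) ^+ i) =
      (-1) ^+ n * fpsX ^+ (\sum_(i < n) (12 * i + j)) *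
      \prod_(i < n) (1 - fpsX ^+ (12 * i + (12 - j))).
    rewrite [X in _ = _ * X](reindex_inj rev_ord_inj) /=.
    rewrite powE expr_sum -!big_split /=.
    apply: eq_bigr => i _; have := ltn_ord i => ilt.
    have -> : (12 * n = (12 * i + j) + (12 * (n - i.+1) + (12 - j)))%N by lia.
    by rewrite exprD -exprM exprD; ring.
  have high : \prod_(i < n)
      (fpsX ^+ (12 * n) + (- fpsX ^+ j) * (fpsX ^+ 12) ^+ (n + i)) =
      fpsX ^+ (12 * n * n) * \prod_(i < n) (1 - fpsX ^+ (12 * i + j)).
    rewrite (exprM _ (12 * n)) powE -big_split /=.
    apply: eq_bigr => i _.
    by rewrite -exprM mulnDr !exprD; ring.
  by rewrite big_split_ord /= low high /D exprD; ring.
rewrite addnn -mul2n qbinomial big_distrr /= /ints big_map.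
have -> m : iota 0 m = index_iota 0 m by rewrite /index_iota subn0.
rewrite big_mkord.
apply: eq_bigr => k _; have := ltn_ord k => klt.
have -> : absz (k%:Z - n%:Z + n%:Z) = k by lia.
have -> : (-1) ^+ absz (k%:Z - n%:Z) = (-1) ^+ n * (-1) ^+ k :> fps.
  by rewrite -exprD -signr_odd -[RHS]signr_odd; congr (_ ^+ _); lia.
(* Completing the shift: 12 C(k,2) + 12n (2n - k) + jk equals [D] plus the exponent [jexp] at k -
   n. *)
have eq_exp : fpsX ^+ 12 ^+ 'C(k, 2) * fpsX ^+ (12 * n) ^+ (2 * n - k) *
    fpsX ^+ j ^+ k = fpsX ^+ D * fpsX ^+ jexp j (k%:Z - n%:Z).
  rewrite -!exprM -!exprD; congr (_ ^+ _).
  have b2 := bin2_double k; have := jexpE (k%:Z - n%:Z) jb.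
  move: b2; move: (jexp _ _) 'C(k, 2)%N => e b; move: klt DE.
  move: (nat_of_ord k) => {}k; nia.
have sq1 : (-1) ^+ n * (-1) ^+ n = 1 :> fps.
  by rewrite -exprD addnn -signr_odd odd_double.
rewrite (exprNn (fpsX ^+ j)).
transitivity ((-1) ^+ k * qbin (fpsX ^+ 12) (2 * n) k *
    (fpsX ^+ 12 ^+ 'C(k, 2) * fpsX ^+ (12 * n) ^+ (2 * n - k) * fpsX ^+ j ^+ k)).
  by ring.
rewrite eq_exp; transitivity ((-1) ^+ k * qbin (fpsX ^+ 12) (2 * n) k *
    (fpsX ^+ D * fpsX ^+ jexp j (k%:Z - n%:Z)) * ((-1) ^+ n * (-1) ^+ n)).
  by rewrite sq1 mulr1.
by ring.
Qed.

(** The product side of Jacobi's triple product, in base q^12 and at the argument q^j. *)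
Definition theta (j : nat) : fps := qprod 12 j * qprod 12 (12 - j) * qprod 12 12.

Definition theta_sum (n j : nat) : fps :=
  \sum_(k <- ints n) (-1) ^+ `|k|%N * fpsX ^+ jexp j k.

Lemma qfact_eqm N m : (N <= m)%N -> eqm N (qfact (fpsX ^+ 12) m) (qprod 12 12).
Proof.
move=> Nm; apply: eqm_sym; apply: eqm_trans (qprod_eqm _ _ Nm) _ => //.
apply: eqm_prod => i _; suff -> : fpsX ^+ 12 ^+ i.+1 = fpsX ^+ (12 * i + 12) by [].
by rewrite -exprM; congr (_ ^+ _); lia.
Qed.

(** Modulo q^N all three q-factorials in [qbin_qfact] become the same infinite product, which is
    invertible and cancels once. *)
Lemma qbin_eqm N m k : (N <= k)%N -> (N + k <= m)%N ->
  eqm N (qbin (fpsX ^+ 12) m k * qprod 12 12) 1.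
Proof.
move=> Nk Nm; set e := qprod 12 12; set b := qbin _ _ _.
have e0 : finv e * e = 1 by rewrite finvK // /e qprod0.
have Nmk : (N <= m - k)%N by lia.
have h : eqm N (b * e * e) e.
  apply: eqm_trans (qfact_eqm (_ : N <= m)%N); last by lia.
  rewrite -(@qbin_qfact _ _ m k); last by lia.
  apply: eqmM; first apply: eqmM => //.
    by apply: eqm_sym; apply: qfact_eqm.
  by apply: eqm_sym; apply: qfact_eqm.
have := eqmM (@eqm_refl N (finv e)) h.
rewrite e0; have -> : finv e * (b * e * e) = finv e * e * (b * e) by ring.
by rewrite e0 mul1r.
Qed.

(** Terms with |k| >= N vanish modulo q^N. For |k| < N, the bound 2N <= n puts both n + k and n - k
    above N, so the Gaussian binomial times [qprod 12 12] is congruent to 1. *)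
Lemma triple_product j N n : (0 < j < 12)%N -> (2 * N <= n)%N ->
  eqm N (theta j) (theta_sum n j).
Proof.
move=> jb Nn; have /andP[j0 j12] := jb.
have Nle : (N <= n)%N by lia.
apply: (@eqm_trans _ ((\prod_(i < n) (1 - fpsX ^+ (12 * i + j))) *
  (\prod_(i < n) (1 - fpsX ^+ (12 * i + (12 - j)))) * qprod 12 12)).
  by apply: eqmM => //; apply: eqmM; apply: qprod_eqm; rewrite ?subn_gt0.
rewrite finite_triple_product // big_distrl /= /theta_sum !big_seq.
apply: eqm_sum => k; rewrite mem_ints => kn.
rewrite [_ * _ * qprod _ _]mulrAC -[_ * _ * qprod _ _]mulrA !(mulrC _ (fpsX ^+ jexp j k)).
have [kN|kN] := leqP N `|k|%N.
  have Nj : (N <= jexp j k)%N by apply: leq_trans kN (jexp_ge _ _).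
  exact: eqm_trans (eqm_Xn0 _ Nj) (eqm_sym (eqm_Xn0 _ Nj)).
apply: eqmM => //; rewrite -[X in eqm _ _ X]mulr1; apply: eqmM => //.
by apply: qbin_eqm; lia.
Qed.

(** * Products of two theta functions *)

Lemma eqm_sum_seq N (T : eqType) (A B : seq T) (f : T -> fps) :
  uniq A -> uniq B ->
  (forall u, u \in A -> u \notin B -> eqm N (f u) 0) ->
  (forall u, u \in B -> u \notin A -> eqm N (f u) 0) ->
  eqm N (\sum_(u <- A) f u) (\sum_(u <- B) f u).
Proof.
move=> uA uB hA hB.
have restrict (C D : seq T) : (forall u, u \in C -> u \notin D -> eqm N (f u) 0) ->
    eqm N (\sum_(u <- C) f u) (\sum_(u <- [seq u <- C | u \in D]) f u).
  move=> h; rewrite (bigID [in D]) /= big_filter -[X in eqm _ _ X]addr0.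
  apply: eqmD => //; rewrite big_seq_cond.
  apply: eqm_trans (_ : eqm _ _ (\sum_(u <- C | (u \in C) && (u \notin D)) 0)) _.
    by apply: eqm_sum => u /andP[]; apply: h.
  by rewrite big1.
apply: eqm_trans (restrict _ _ hA) _; apply: eqm_sym.
apply: eqm_trans (restrict _ _ hB) _.
rewrite (perm_big [seq u <- A | u \in B]) //.
by apply: uniq_perm; rewrite ?filter_uniq // => u; rewrite !mem_filter andbC.
Qed.

(* The shift by 3 keeps the exponents nonnegative for [j <= 6]. *)
Definition gexp (j : nat) (s : int) : nat := `|3 * s * s + j%:Z * s + 3|.

(** The growth needed to discard large |s|. Equality holds at s = -1, j = 6, so the bound cannot be
    raised to |s|. *)
Lemma gexp_bound j (s : int) : (j <= 6)%N -> `|s| - 1 <= 3 * s * s + j%:Z * s + 3.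
Proof.
move=> j6; have [s0|s0] := lerP 0 s.
  have : 0 <= j%:Z * s by apply: mulr_ge0; lia.
  have : 0 <= (s - 1) * (s - 1) by rewrite -expr2 sqr_ge0.
  lia.
have : 0 <= (- s) * (6 - j%:Z) by apply: mulr_ge0; lia.
have : 0 <= (- s - 1) * (- s - 1) by apply: mulr_ge0; lia.
have [->|?] : s = -1 \/ s <= - 2 by lia.
  lia.
have : 0 <= (- s - 2) * (- s - 1) by apply: mulr_ge0; lia.
lia.
Qed.

Lemma gexpE j s : (j <= 6)%N -> (gexp j s)%:Z = 3 * s * s + j%:Z * s + 3.
Proof.
move=> j6; have := gexp_bound s j6; rewrite /gexp.
by have [->|] := eqVneq s 0; lia.
Qed.

Lemma gexp_ge j s : (j <= 6)%N -> (`|s| <= (gexp j s).+1)%N.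
Proof. by move=> j6; have := gexp_bound s j6; rewrite -gexpE //; lia. Qed.

(** Finite versions of the series O ([b] true) and V ([b] false), up to the shift by q^3. *)
Definition parity_sum (b : bool) (n j : nat) : fps :=
  \sum_(s <- ints n | odd `|s|%N == b) fpsX ^+ gexp j s.

(** A bijection from all integer pairs onto the pairs with odd sum; it removes the cross terms
    between [x] and [z] from the exponent. *)
Definition rotate (u : int * int) : int * int := (u.1 + u.2 - 1, u.1 - u.2).

Lemma rotate_inj : injective rotate.
Proof.
move=> [a b] [c d] [h1 h2].
by congr (_, _); lia.
Qed.

(** With s = a + b - 1 and t = a - b, the two triple product exponents add up to 3s^2 + xs + 3t^2 +
    zt + x - 3. The two shifts by 3 in [gexp] then leave the prefactor q^(9-x). *)
Lemma theta_mul N n x z : (z < x)%N -> (x <= 6)%N -> (x + z < 12)%N -> (2 * N <= n)%N ->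
  eqm N (fpsX ^+ (9 - x) * (theta (x + z) * theta (x - z)))
    (parity_sum true n x * parity_sum false n z -
     parity_sum false n x * parity_sum true n z).
Proof.
move=> zx x6 xz Nn.
have b1 : (0 < x + z < 12)%N by lia.
have b2 : (0 < x - z < 12)%N by lia.
have z6 : (z <= 6)%N by lia.
pose f (v : int * int) : fps :=
  (-1) ^+ (`|v.1|%N).+1 * fpsX ^+ (gexp x v.1 + gexp z v.2).
pose box := [seq (a, b) | a <- ints n, b <- ints n].
have ubox : uniq box.
  by apply: allpairs_uniq; rewrite ?ints_uniq // => -[a b] [c d].
have mbox a b : ((a, b) \in box) = (`|a| <= n)%N && (`|b| <= n)%N.
  rewrite -!mem_ints; apply/allpairsP/andP => [[[c d] /= [hc hd [-> ->]]] //|[ha hb]].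
  by exists (a, b).
have fE a b : fpsX ^+ (9 - x) *
    ((-1) ^+ `|a|%N * fpsX ^+ jexp (x + z) a * ((-1) ^+ `|b|%N * fpsX ^+ jexp (x - z) b))
    = f (rotate (a, b)).
  rewrite /f /=.
  have -> : (-1) ^+ (absz (a + b - 1)%R).+1 = (-1) ^+ `|a|%N * (-1) ^+ `|b|%N :> fps.
    by rewrite -exprD -signr_odd -[RHS]signr_odd; congr (_ ^+ _); lia.
  have -> : (gexp x (a + b - 1)%R + gexp z (a - b)%R =
      (9 - x) + (jexp (x + z) a + jexp (x - z) b))%N.
    have := jexpE a b1; have := jexpE b b2.
    have := gexpE (a + b - 1) x6; have := gexpE (a - b) z6.
    lia.
  by rewrite !exprD; ring.
pose oddbox : seq (int * int) := [seq v : int * int <- box | odd (absz (v.1 + v.2))].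
apply: (@eqm_trans _ (\sum_(v <- [seq rotate u | u <- box]) f v)).
  have -> : \sum_(v <- [seq rotate u | u <- box]) f v =
      fpsX ^+ (9 - x) * (theta_sum n (x + z) * theta_sum n (x - z)).
    rewrite big_map big_allpairs /= big_distrlr /= big_distrr /=.
    apply: eq_bigr => a _; rewrite big_distrr /=; apply: eq_bigr => b _.
    by rewrite fE.
  by apply: eqmM => //; apply: eqmM; apply: triple_product.
(* The rotated square and the odd-sum points of the square are different sets, but every point in
   only one of them carries an exponent of at least N. *)
apply: (@eqm_trans _ (\sum_(v <- oddbox) f v)).
  apply: eqm_sum_seq; rewrite ?filter_uniq ?(map_inj_uniq rotate_inj) //.
    move=> _ /mapP[[a b] _ ->]; rewrite mem_filter mbox.
    rewrite -[rotate (a, b)]/((a : int) + b - 1, (a : int) - b) /= => h.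
    rewrite /f mulrC; apply: eqm_Xn0; move: h => /=.
    have : odd (absz ((a : int) + b - 1 + ((a : int) - b))) by lia.
    move=> -> /=; move: ((a : int) + b - 1) ((a : int) - b) => s t /= h.
    have := gexp_ge s x6; have := gexp_ge t z6; lia.
  move=> [s t]; rewrite mem_filter => /andP[st _] h.
  have {}st : odd (absz ((s : int) + t)) by exact: st.
  have [a [b stE]] : exists a b : int, (s, t) = rotate (a, b).
    exists ((s + t + 1) %/ 2)%Z, ((s + 1 - t) %/ 2)%Z.
    by rewrite /rotate /=; congr (_, _); lia.
  have : (a, b) \notin box.
    by apply/negP => ab; move/negP: h; apply; rewrite stE; apply: map_f.
  rewrite stE mbox -fE => ab.
  have -> : fpsX ^+ (9 - x) * ((-1) ^+ `|a|%N * fpsX ^+ jexp (x + z) a *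
      ((-1) ^+ `|b|%N * fpsX ^+ jexp (x - z) b)) =
      fpsX ^+ (jexp (x + z) a + jexp (x - z) b) *
      (fpsX ^+ (9 - x) * (-1) ^+ `|a|%N * (-1) ^+ `|b|%N).
    by rewrite exprD; ring.
  by apply: eqm_Xn0; have := jexp_ge a b1; have := jexp_ge b b2; lia.
(* An odd sum means that exactly one coordinate is odd; the sign (-1)^(s+1) is + when it is the
   first and - when it is the second. *)
have -> : \sum_(v <- oddbox) f v = parity_sum true n x * parity_sum false n z -
     parity_sum false n x * parity_sum true n z; last by [].
rewrite big_filter big_mkcond big_allpairs /parity_sum /= !(big_mkcond (fun s => odd _ == _)) /=.
rewrite !big_distrlr /= -sumrB; apply: eq_bigr => s _.
rewrite -sumrB; apply: eq_bigr => t _.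
have -> : odd (absz (s + t)) = odd `|s|%N (+) odd `|t|%N by lia.
rewrite /f /= -signr_odd /= exprD.
by case: (odd `|s|%N); case: (odd `|t|%N); rewrite /= ?mulr0 ?mul0r ?subr0 ?sub0r ?expr0 ?expr1 ?mul1r ?mulN1r.
Qed.

(** * The three-term relation and the eta quotients *)

(** By [theta_mul], each pair of thetas is, up to a power of q, a 2 by 2 minor of the matrix with
    rows O and V. The power q^(b-c) is the discrepancy between the prefactors q^(9-c) and
    q^(9-b). *)
Lemma theta_three_term a b c d : (d < c)%N -> (c < b)%N -> (b < a)%N -> (a <= 6)%N ->
  fpsX ^+ (b - c) * (theta (a + b) * theta (a - b) * (theta (c + d) * theta (c - d))) =
  theta (a + c) * theta (a - c) * (theta (b + d) * theta (b - d)) -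
  theta (a + d) * theta (a - d) * (theta (b + c) * theta (b - c)).
Proof.
move=> dc cb ba a6.
have X0 : fpsX ^+ (9 - a) * fpsX ^+ (9 - b) != 0 by rewrite mulf_neq0 ?expf_neq0 ?fpsX_neq0.
apply: (mulfI X0); apply: eqmP => N.
pose F x z := theta (x + z) * theta (x - z).
pose G x z := parity_sum true (2 * N) x * parity_sum false (2 * N) z -
     parity_sum false (2 * N) x * parity_sum true (2 * N) z.
have FG x z : (z < x)%N -> (x <= 6)%N -> (x + z < 12)%N ->
    eqm N (fpsX ^+ (9 - x) * F x z) (G x z) by move=> *; apply: theta_mul.
have FG2 x z x' z' : (z < x)%N -> (x <= 6)%N -> (x + z < 12)%N ->
    (z' < x')%N -> (x' <= 6)%N -> (x' + z' < 12)%N ->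
    eqm N (fpsX ^+ (9 - x) * F x z * (fpsX ^+ (9 - x') * F x' z')) (G x z * G x' z').
  by move=> *; apply: eqmM; apply: FG.
rewrite -/(F a b) -/(F c d) -/(F a c) -/(F b d) -/(F a d) -/(F b c).
have -> : fpsX ^+ (9 - a) * fpsX ^+ (9 - b) * (fpsX ^+ (b - c) * (F a b * F c d)) =
    fpsX ^+ (9 - a) * F a b * (fpsX ^+ (9 - c) * F c d).
  have -> : (9 - c = (9 - b) + (b - c))%N by lia.
  by rewrite [fpsX ^+ (_ + _)]exprD; ring.
have -> : fpsX ^+ (9 - a) * fpsX ^+ (9 - b) * (F a c * F b d - F a d * F b c) =
    fpsX ^+ (9 - a) * F a c * (fpsX ^+ (9 - b) * F b d) -
    fpsX ^+ (9 - a) * F a d * (fpsX ^+ (9 - b) * F b c) by ring.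
apply: eqm_trans (FG2 _ _ _ _ _ _ _ _ _ _) _; try lia.
apply: eqm_sym; apply: eqm_trans (eqmB (FG2 _ _ _ _ _ _ _ _ _ _) (FG2 _ _ _ _ _ _ _ _ _ _)) _; try lia.
(* The Pluecker relation among the minors of a 2 by 4 matrix. *)
suff -> : G a c * G b d - G a d * G b c = G a b * G c d by [].
by rewrite /G; ring.
Qed.

Lemma Ek_split d : (0 < d)%N -> (d %| 12)%N ->
  Ek d = \prod_(r < 12 %/ d) qprod 12 (d * r + d).
Proof.
move=> d0 d12; have q0 : (0 < 12 %/ d)%N by rewrite divn_gt0 // dvdn_leq.
by rewrite (Ek_qprod d0) (qprod_split q0 d0 d0) divnK.
Qed.

(** The three-term relation at (6, 4, 3, 0), times an eta product: over base q^12 both sides are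
    polynomials in the same [qprod 12 j]. In terms of r, it says that the fifth root of [kappa] is 1
    / (1 - r). *)
Lemma eta_identity_kappa :
  Ek 6 ^+ 9 * Ek 1 * Ek 4 ^+ 2 =
  (Ek 4 ^+ 4 * Ek 6 ^+ 2 - fpsX * Ek 2 ^+ 2 * Ek 12 ^+ 4) *
  (Ek 2 * Ek 12 ^+ 2 * Ek 3 ^+ 3).
Proof.
have := @theta_three_term 6 4 3 0 isT isT isT isT; rewrite /= => h.
apply/eqP; rewrite eq_sym -subr_eq0; apply/eqP.
transitivity (Ek 6 ^+ 4 * Ek 4 ^+ 2 * Ek 2 * Ek 3 *
   (theta 9 * theta 3 * (theta 4 * theta 4) - theta 6 * theta 6 * (theta 7 * theta 1)
    - fpsX ^+ 1 * (theta 10 * theta 2 * (theta 3 * theta 3)))); last first.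
  by rewrite h subrr mulr0.
rewrite (@Ek_split 1 isT isT) (@Ek_split 2 isT isT) (@Ek_split 3 isT isT)
  (@Ek_split 4 isT isT) (@Ek_split 6 isT isT) (@Ek_split 12 isT isT).
rewrite !big_ord_recr !big_ord0 /theta /=.
ring.
Qed.

(** The three-term relation at (6, 4, 2, 0). After division it reads y - 1 = r^2 y. *)
Lemma eta_identity_xi_dil :
  Ek 4 ^+ 8 * Ek 12 * Ek 6 ^+ 4 - Ek 2 * Ek 4 ^+ 3 * Ek 6 ^+ 9 =
  fpsX ^+ 2 * Ek 2 ^+ 4 * Ek 12 ^+ 9.
Proof.
have := @theta_three_term 6 4 2 0 isT isT isT isT; rewrite /= => h.
apply/eqP; rewrite -subr_eq0; apply/eqP.
transitivity (Ek 4 ^+ 4 * Ek 6 ^+ 4 * Ek 12 *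
   (theta 8 * theta 4 * (theta 4 * theta 4) - theta 6 * theta 6 * (theta 6 * theta 2)
    - fpsX ^+ 2 * (theta 10 * theta 2 * (theta 2 * theta 2)))); last first.
  by rewrite h subrr mulr0.
rewrite (@Ek_split 2 isT isT)
  (@Ek_split 4 isT isT) (@Ek_split 6 isT isT) (@Ek_split 12 isT isT).
rewrite !big_ord_recr !big_ord0 /theta /=.
ring.
Qed.

Lemma fdil_Ek k l : (0 < k)%N -> (0 < l)%N -> fdil k (Ek l) = Ek (k * l).
Proof. by move=> k0 l0; rewrite /Ek fdil_comp_mul. Qed.

(** All exponents in [eta_identity_xi_dil] are even, so it is the image of this identity under q ->
    q^2, which is injective. *)
Lemma eta_identity_xi :
  Ek 2 ^+ 8 * Ek 6 * Ek 3 ^+ 4 - Ek 1 * Ek 2 ^+ 3 * Ek 3 ^+ 9 =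
  fpsX * Ek 1 ^+ 4 * Ek 6 ^+ 9.
Proof.
apply: (@fdil_inj 2 isT).
have dilM a b : fdil 2 (a * b) = fdil 2 a * fdil 2 b := @fdilM 2 isT a b.
have dilX a m : fdil 2 (a ^+ m) = fdil 2 a ^+ m := @fdilXn 2 a m isT.
have dilE l (l0 : (0 < l)%N) := @fdil_Ek 2 l isT l0.
have h := eta_identity_xi_dil.
rewrite -(dilE 1%N isT) -(dilE 2%N isT) -(dilE 3%N isT) -(dilE 6%N isT)
  -(fdilX (isT : (0 < 2)%N)) in h.
move: (Ek 1) (Ek 2) (Ek 3) (Ek 6) fpsX h => e1 e2 e3 e6 q h.
rewrite fdilB (dilM (_ * e6) _) (dilM _ e6) (dilM (e1 * _) _) (dilM e1 _).
rewrite (dilM (q * _) _) (dilM q _).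
rewrite (dilX e1 4%N) (dilX e2 8%N) (dilX e2 3%N) (dilX e3 4%N) (dilX e3 9%N) (dilX e6 9%N).
exact: h.
Qed.

Lemma Ek_coef0 k : Ek k 0%N = 1.
Proof. by rewrite /Ek /fdil dvdn0 div0n E_qprod qprod0. Qed.

Lemma fps_exp_coef0 (a : fps) m : a 0%N = 1 -> (a ^+ m) 0%N = 1.
Proof.
by move=> a0; elim: m => // m IH; rewrite exprS [LHS]big_ord1 a0 IH mulr1.
Qed.

Lemma fpsM_coef0 (a b : fps) : a 0%N = 1 -> b 0%N = 1 -> (a * b) 0%N = 1.
Proof. by move=> a0 b0; rewrite [LHS]big_ord1 a0 b0 mulr1. Qed.

(** * Eta quotients in the fraction field *)

Local Notation "x %:F" := (@FracField.tofrac _ x).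

Lemma tofrac_finv (a : fps) : a 0%N = 1 -> (finv a)%:F = (a%:F)^-1.
Proof.
move=> a1; have a0 : a 0%N != 0 by rewrite a1 oner_eq0.
have aF : a%:F != 0 by rewrite tofrac_eq0 neq0_coef0.
by apply: (mulIf aF); rewrite mulVf // -tofracM finvK // tofrac1.
Qed.

Lemma fdil_finv k (a : fps) : (0 < k)%N -> a 0%N = 1 -> fdil k (finv a) = finv (fdil k a).
Proof.
move=> k0 a1; have a0 : a 0%N != 0 by rewrite a1 oner_eq0.
have d0 : fdil k a 0%N != 0 by rewrite /fdil dvdn0 div0n.
by apply: (mulIf (neq0_coef0 d0)); rewrite -fdilM // !finvK // fdil1.
Qed.

Definition eF k : {fraction fps} := (Ek k)%:F.

Lemma eF_neq0 k : eF k != 0.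
Proof. by rewrite tofrac_eq0 neq0_coef0 // Ek_coef0 oner_eq0. Qed.

Lemma tofrac_xi_quotient (a b c d : fps) : c 0%N = 1 -> d 0%N = 1 ->
  (a ^+ 5 * b * finv (c * d ^+ 5))%:F = a%:F ^+ 5 * b%:F / (c%:F * d%:F ^+ 5).
Proof.
move=> c1 d1; rewrite (tofracM _ (finv _)) (tofracM _ b) (tofracXn 5 a) tofrac_finv.
  by rewrite (tofracM c) (tofracXn 5 d).
by rewrite fpsM_coef0 // fps_exp_coef0.
Qed.

Lemma tofrac_xi : xi%:F = eF 2 ^+ 5 * eF 6 / (eF 1 * eF 3 ^+ 5).
Proof. by rewrite /xi !fexpE; apply: tofrac_xi_quotient; apply: Ek_coef0. Qed.

(** Pure field algebra: the three eta identities become k (1 - r) = 1, y - 1 = r^2 y and xi - 1 = r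
    y^2 / k^3, where k is the fifth root of [kappa]. The first two also show that 1 - r and 1 + r
    are nonzero. *)
Lemma eta_parametrization (F : fieldType) (q e1 e2 e3 e4 e6 e12 : F) :
  e1 != 0 -> e2 != 0 -> e3 != 0 -> e4 != 0 -> e6 != 0 -> e12 != 0 ->
  e6 ^+ 9 * e1 * e4 ^+ 2 =
    (e4 ^+ 4 * e6 ^+ 2 - q * e2 ^+ 2 * e12 ^+ 4) * (e2 * e12 ^+ 2 * e3 ^+ 3) ->
  e4 ^+ 8 * e12 * e6 ^+ 4 - e2 * e4 ^+ 3 * e6 ^+ 9 = q ^+ 2 * e2 ^+ 4 * e12 ^+ 9 ->
  e2 ^+ 8 * e6 * e3 ^+ 4 - e1 * e2 ^+ 3 * e3 ^+ 9 = q * e1 ^+ 4 * e6 ^+ 9 ->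
  exists r : F, [/\ 1 - r != 0, 1 + r != 0,
    e2 * e4 ^+ 2 * e12 ^+ 2 * e3 ^+ 3 / (e6 ^+ 7 * e1) = (1 - r)^-1,
    e4 ^+ 5 * e12 / (e2 * e6 ^+ 5) = ((1 - r) * (1 + r))^-1 &
    e2 ^+ 5 * e6 / (e1 * e3 ^+ 5) = 1 + r * (1 - r) / (1 + r) ^+ 2].
Proof.
move=> n1 n2 n3 n4 n6 n12 h1 h2 h3.
pose r := q * e2 ^+ 2 * e12 ^+ 4 / (e4 ^+ 4 * e6 ^+ 2).
pose k := e2 * e4 ^+ 2 * e12 ^+ 2 * e3 ^+ 3 / (e6 ^+ 7 * e1).
pose y := e4 ^+ 5 * e12 / (e2 * e6 ^+ 5).
have k1 : k * (1 - r) = 1.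
  transitivity ((e4 ^+ 4 * e6 ^+ 2 - q * e2 ^+ 2 * e12 ^+ 4) *
      (e2 * e12 ^+ 2 * e3 ^+ 3) / (e6 ^+ 9 * e1 * e4 ^+ 2)).
    by rewrite /k /r; field; rewrite ?n1 ?n4 ?n6.
  by rewrite -h1 mulfV // !mulf_neq0 ?expf_neq0.
have y1 : y * ((1 - r) * (1 + r)) = 1.
  have : y - 1 = r ^+ 2 * y.
    transitivity ((e4 ^+ 8 * e12 * e6 ^+ 4 - e2 * e4 ^+ 3 * e6 ^+ 9) /
        (e2 * e4 ^+ 3 * e6 ^+ 9)).
      by rewrite /y; field; rewrite ?n2 ?n4 ?n6.
    by rewrite h2 /y /r; field; rewrite ?n2 ?n4 ?n6.
  move=> yr; transitivity (y - r ^+ 2 * y); first by ring.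
  by rewrite -yr; ring.
have nr : 1 - r != 0.
  by apply: contraTneq (oner_neq0 F) => r0; rewrite -k1 r0 mulr0 eqxx.
have pr : 1 + r != 0.
  by apply: contraTneq (oner_neq0 F) => r0; rewrite -y1 r0 !mulr0 eqxx.
have kE : k = (1 - r)^-1 by apply: (mulIf nr); rewrite k1 mulVf.
have yE : y = ((1 - r) * (1 + r))^-1.
  have nn : (1 - r) * (1 + r) != 0 by rewrite mulf_neq0.
  by apply: (mulIf nn); rewrite y1 mulVf.
exists r; split=> //.
(* In q E_1^3 E_6^9 / (E_2^3 E_3^9), the combination r y^2 / k^3 is found by making E_4 and E_12
   cancel. *)
have : e2 ^+ 5 * e6 / (e1 * e3 ^+ 5) - 1 = r * y ^+ 2 / k ^+ 3.
  transitivity ((e2 ^+ 8 * e6 * e3 ^+ 4 - e1 * e2 ^+ 3 * e3 ^+ 9) /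
      (e1 * e2 ^+ 3 * e3 ^+ 9)).
    by field; rewrite ?n1 ?n2 ?n3.
  by rewrite h3 /y /r /k; field; rewrite ?n1 ?n2 ?n3 ?n4 ?n6 ?n12.
move=> /(canRL (subrK _)) ->; rewrite kE yE.
by field; rewrite nr pr oner_neq0.
Qed.

Lemma tofrac_fdil2_xi : (fdil 2 xi)%:F = eF 4 ^+ 5 * eF 12 / (eF 2 * eF 6 ^+ 5).
Proof.
have dil (a b c d : fps) : a 0%N = 1 -> c 0%N = 1 ->
    fdil 2 (d ^+ 5 * b * finv (a * c ^+ 5)) =
    fdil 2 d ^+ 5 * fdil 2 b * finv (fdil 2 a * fdil 2 c ^+ 5).
  move=> a1 c1.
  have dilM u v : fdil 2 (u * v) = fdil 2 u * fdil 2 v := @fdilM 2 isT u v.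
  have dilX u m : fdil 2 (u ^+ m) = fdil 2 u ^+ m := @fdilXn 2 u m isT.
  rewrite (dilM (_ * b)) (dilM _ b) (dilX d 5%N) (@fdil_finv 2 _ isT).
    by rewrite (dilM a) (dilX c 5%N).
  by rewrite fpsM_coef0 // fps_exp_coef0.
have := dil (Ek 1) (Ek 6) (Ek 3) (Ek 2) (Ek_coef0 _) (Ek_coef0 _).
rewrite (@fdil_Ek 2 1 isT isT) (@fdil_Ek 2 2 isT isT) (@fdil_Ek 2 3 isT isT) (@fdil_Ek 2 6 isT isT).
rewrite -!fexpE => h.
have -> : fdil 2 xi = _ := h.
by rewrite !fexpE; apply: tofrac_xi_quotient; apply: Ek_coef0.
Qed.

(** Ensures that the [finv gamma] inside [kappa] is a genuine inverse. *)
Lemma gamma_coef0 : gamma 0%N = 1.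
Proof.
have gE : gamma * Ek 3 ^+ 15 = Ek 1 ^+ 5 * Ek 2 ^+ 5 * Ek 6 ^+ 5.
  rewrite /gamma !fexpE -[LHS]mulrA.
  by rewrite -[RHS]mulr1 finvK // fps_exp_coef0 ?Ek_coef0 ?oner_eq0.
have := congr1 (fun a : fps => a 0%N) gE.
rewrite [gamma * _]lock [LHS]/= -lock [LHS]big_ord1 fps_exp_coef0 ?Ek_coef0 // mulr1 => ->.
by rewrite !fpsM_coef0 // fps_exp_coef0 // Ek_coef0.
Qed.

Lemma tofrac_gamma_quotient (a b c d : fps) : d 0%N = 1 ->
  (a ^+ 5 * b ^+ 5 * c ^+ 5 * finv (d ^+ 15))%:F =
  a%:F ^+ 5 * b%:F ^+ 5 * c%:F ^+ 5 / d%:F ^+ 15.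
Proof.
move=> d1; rewrite (tofracM _ (finv _)) (tofracM _ (c ^+ 5)) (tofracM _ (b ^+ 5)).
rewrite tofrac_finv ?fps_exp_coef0 //.
by rewrite (tofracXn 5 a) (tofracXn 5 b) (tofracXn 5 c) (tofracXn 15 d).
Qed.

Lemma tofrac_gamma :
  gamma%:F = eF 1 ^+ 5 * eF 2 ^+ 5 * eF 6 ^+ 5 / eF 3 ^+ 15.
Proof. by rewrite /gamma !fexpE; apply: tofrac_gamma_quotient; apply: Ek_coef0. Qed.

Lemma tofrac_fdil2_gamma :
  (fdil 2 gamma)%:F = eF 2 ^+ 5 * eF 4 ^+ 5 * eF 12 ^+ 5 / eF 6 ^+ 15.
Proof.
have dil (a b c d : fps) : d 0%N = 1 ->
    fdil 2 (a ^+ 5 * b ^+ 5 * c ^+ 5 * finv (d ^+ 15)) =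
    fdil 2 a ^+ 5 * fdil 2 b ^+ 5 * fdil 2 c ^+ 5 * finv (fdil 2 d ^+ 15).
  move=> d1.
  have dilM u v : fdil 2 (u * v) = fdil 2 u * fdil 2 v := @fdilM 2 isT u v.
  have dilX u m : fdil 2 (u ^+ m) = fdil 2 u ^+ m := @fdilXn 2 u m isT.
  rewrite (dilM (_ * c ^+ 5)) (dilM _ (c ^+ 5)) (dilM (a ^+ 5)) (@fdil_finv 2 _ isT).
    by rewrite (dilX a 5%N) (dilX b 5%N) (dilX c 5%N) (dilX d 15%N).
  by rewrite fps_exp_coef0.
have := dil (Ek 1) (Ek 2) (Ek 6) (Ek 3) (Ek_coef0 _).
rewrite (@fdil_Ek 2 1 isT isT) (@fdil_Ek 2 2 isT isT) (@fdil_Ek 2 3 isT isT) (@fdil_Ek 2 6 isT isT).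
rewrite -!fexpE => h.
have -> : fdil 2 gamma = _ := h.
by rewrite !fexpE; apply: tofrac_gamma_quotient; apply: Ek_coef0.
Qed.

Lemma kappa_eta_quotient (F : fieldType) (e1 e2 e3 e4 e6 e12 : F) :
  e1 != 0 -> e2 != 0 -> e3 != 0 -> e6 != 0 ->
  (e2 ^+ 5 * e4 ^+ 5 * e12 ^+ 5 / e6 ^+ 15) ^+ 2 / (e1 ^+ 5 * e2 ^+ 5 * e6 ^+ 5 / e3 ^+ 15) =
  (e2 * e4 ^+ 2 * e12 ^+ 2 * e3 ^+ 3 / (e6 ^+ 7 * e1)) ^+ 5.
Proof. by move=> n1 n2 n3 n6; field; rewrite n1 n2 n3 n6. Qed.

Lemma tofrac_kappa :
  kappa%:F = (eF 2 * eF 4 ^+ 2 * eF 12 ^+ 2 * eF 3 ^+ 3 / (eF 6 ^+ 7 * eF 1)) ^+ 5.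
Proof.
rewrite /kappa !fexpE (tofracM _ (finv gamma)) (tofrac_finv gamma_coef0) (tofracXn 2).
rewrite tofrac_fdil2_gamma tofrac_gamma.
move: (eF_neq0 1) (eF_neq0 2) (eF_neq0 3) (eF_neq0 6) (eF_neq0 4) (eF_neq0 12).
move: (eF 1) (eF 2) (eF 3) (eF 4) (eF 6) (eF 12) => e1 e2 e3 e4 e6 e12 n1 n2 n3 n6 n4 n12.
exact: kappa_eta_quotient.
Qed.

Lemma xi_kappa_parametrization : exists r : {fraction fps},
  [/\ 1 - r != 0, 1 + r != 0, kappa%:F = (1 - r)^-1 ^+ 5,
    (fdil 2 xi)%:F = ((1 - r) * (1 + r))^-1 &
    xi%:F = 1 + r * (1 - r) / (1 + r) ^+ 2].
Proof.
have tF (a b : fps) : a = b -> a%:F = b%:F by move->.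
have := @eta_parametrization _ (fpsX%:F) _ _ _ _ _ _
  (eF_neq0 1) (eF_neq0 2) (eF_neq0 3) (eF_neq0 4) (eF_neq0 6) (eF_neq0 12).
rewrite tofrac_kappa tofrac_fdil2_xi tofrac_xi /eF.
rewrite -!tofracXn -!tofracM -!tofracB -!tofracM.
move=> /(_ (tF _ _ eta_identity_kappa) (tF _ _ eta_identity_xi_dil) (tF _ _ eta_identity_xi)).
by move=> [r [nr pr -> -> ->]]; exists r.
Qed.

(** * Quadratic equations over series in q^2, and the operator U *)

Lemma fscaleE n (a : fps) : fscale n%:R a = n%:R * a.
Proof.
rewrite mulr_natl; apply/funext => m; rewrite /fscale mulr_natl.
elim: n => [|n IH]; first by rewrite !mulr0n fps0E.
by rewrite !mulrS fpsDE IH.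
Qed.

Lemma fsubE (a b : fps) : fsub a b = a - b.
Proof. by apply/funext => n; rewrite fpsDE fpsNE. Qed.

Lemma fdilD k : {morph fdil k : a b / a + b >-> a + b}.
Proof.
move=> a b; apply/funext => n; rewrite fpsDE /fdil.
by case: ifP; rewrite ?addr0.
Qed.

Lemma fdil_nat k n : (0 < k)%N -> fdil k n%:R = n%:R.
Proof.
move=> k0; elim: n => [|n IH]; last by rewrite !mulrS fdilD fdil1 // IH.
by rewrite mulr0n; apply/funext => m; rewrite /fdil !fps0E if_same.
Qed.

Lemma U_dil_mul (a b : fps) : U (fdil 2 a * b) = a * U b.
Proof.
apply/funext => n; rewrite /U.
pose f k := fdil 2 a k * b (2 * n - k)%N.
(* A series in q^2 has no odd coefficients, so only even indices contribute to the convolution. *)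
have even_sum (m : nat) : \sum_(k < (2 * m).+1) f k = \sum_(k < m.+1) f (2 * k)%N.
  elim: m => [|m IH]; first by rewrite !big_ord1.
  rewrite [RHS]big_ord_recr -IH mulnS !addSn add0n !big_ord_recr /=.
  suff -> : f (2 * m).+1 = 0 by rewrite addr0.
  by rewrite /f /fdil dvdn2 /= oddM /= mul0r.
rewrite [LHS]even_sum; apply: eq_bigr => k _.
by rewrite /f /fdil dvdn_mulr // mulKn // -mulnBr.
Qed.

(** [y] is invariant under r -> -r, so x = (1 + 3r) / (1 + r)^2 and its conjugate have sum 2 (1 -
    5r^2) y^2 and product (1 - 9r^2) y^2; substituting r^2 = (y - 1) / y gives the coefficients. *)
Lemma xi_quadratic_rational (F : fieldType) (r y : F) :
  1 - r != 0 -> 1 + r != 0 -> y = ((1 - r) * (1 + r))^-1 ->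
  let x := 1 + r * (1 - r) / (1 + r) ^+ 2 in
  x ^+ 2 = (10%:R * y - 8%:R * y ^+ 2) * x - (9%:R * y - 8%:R * y ^+ 2).
Proof. by move=> nr pr ->; field; rewrite nr pr. Qed.

(** The conjugate root is (1 + r)^(-5): the product is y^5 and the sum is (2 + 20r^2 + 10r^4) y^5,
    again with r^2 = (y - 1) / y. *)
Lemma kappa_quadratic_rational (F : fieldType) (r y : F) :
  1 - r != 0 -> 1 + r != 0 -> y = ((1 - r) * (1 + r))^-1 ->
  let k := (1 - r)^-1 ^+ 5 in
  k ^+ 2 = (10%:R * y ^+ 3 - 40%:R * y ^+ 4 + 32%:R * y ^+ 5) * k - y ^+ 5.
Proof. by move=> nr pr ->; field; rewrite nr pr. Qed.

Lemma xi_quadratic :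
  xi ^+ 2 = fdil 2 (10%:R * xi - 8%:R * xi ^+ 2) * xi - fdil 2 (9%:R * xi - 8%:R * xi ^+ 2).
Proof.
have [r [nr pr _ yE xE]] := xi_kappa_parametrization.
have dilM u v : fdil 2 (u * v) = fdil 2 u * fdil 2 v := @fdilM 2 isT u v.
have dilX u m : fdil 2 (u ^+ m) = fdil 2 u ^+ m := @fdilXn 2 u m isT.
rewrite !fdilB (dilM 10%:R) (dilM 8%:R) (dilM 9%:R) (dilX xi 2%N) !(fdil_nat _ (isT : (0 < 2)%N)).
move: xi (fdil 2 xi) yE xE => x y yE xE.
apply/eqP; rewrite -tofrac_eq; apply/eqP.
have tofracMf (u v : fps) : (u * v)%:F = u%:F * v%:F := tofracM u v.
have natF n : (n%:R : fps)%:F = n%:R by exact: rmorph_nat.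
rewrite tofracB (tofracMf _ x) !tofracB (tofracMf 10%:R) (tofracMf 9%:R) !(tofracMf 8%:R).
rewrite !natF (tofracXn 2 x) !(tofracXn 2 y) xE.
exact: xi_quadratic_rational.
Qed.

Lemma kappa_quadratic :
  kappa ^+ 2 = fdil 2 (10%:R * xi ^+ 3 - 40%:R * xi ^+ 4 + 32%:R * xi ^+ 5) * kappa -
    fdil 2 (xi ^+ 5).
Proof.
have [r [nr pr kE yE _]] := xi_kappa_parametrization.
have dilM u v : fdil 2 (u * v) = fdil 2 u * fdil 2 v := @fdilM 2 isT u v.
have dilX u m : fdil 2 (u ^+ m) = fdil 2 u ^+ m := @fdilXn 2 u m isT.
rewrite fdilD fdilB (dilM 10%:R) (dilM 40%:R) (dilM 32%:R).
rewrite (dilX xi 3%N) (dilX xi 4%N) (dilX xi 5%N) !(fdil_nat _ (isT : (0 < 2)%N)).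
move: (fdil 2 xi) kappa yE kE => y k yE kE.
apply/eqP; rewrite -tofrac_eq; apply/eqP.
have tofracMf (u v : fps) : (u * v)%:F = u%:F * v%:F := tofracM u v.
have natF n : (n%:R : fps)%:F = n%:R by exact: rmorph_nat.
rewrite tofracB (tofracMf _ k) tofracD tofracB (tofracMf 10%:R) (tofracMf 40%:R) (tofracMf 32%:R).
rewrite !natF (tofracXn 2 k) (tofracXn 3 y) (tofracXn 4 y) (tofracXn 5 y) kE.
exact: kappa_quadratic_rational.
Qed.

(** The common source of both recurrences: [x] is [kappa] or [xi], and [c] collects the remaining
    powers. *)
Lemma U_quadratic (a b x c : fps) : x ^+ 2 = fdil 2 a * x - fdil 2 b ->
  U (x ^+ 2 * c) = a * U (x * c) - b * U c.
Proof.
move=> ->; rewrite -!U_dil_mul mulrBl -mulrA.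
by apply/funext => n; rewrite fpsDE fpsNE /U fpsDE fpsNE.
Qed.

Theorem theorem2p4 :
  (forall i j : nat, (2 <= i)%N ->
     zeta i j =
     fsub (fmul (fadd (fsub (fscale 10 (fexp xi 3)) (fscale 40 (fexp xi 4)))
                      (fscale 32 (fexp xi 5)))
                (zeta i.-1 j))
          (fmul (fexp xi 5) (zeta i.-2 j)))
  /\
  (forall i j : nat, (2 <= j)%N ->
     zeta i j =
     fsub (fmul (fsub (fscale 10 xi) (fscale 8 (fexp xi 2))) (zeta i j.-1))
          (fmul (fsub (fscale 9 xi) (fscale 8 (fexp xi 2))) (zeta i j.-2))).
Proof.
have zetaE i j : zeta i j = U (kappa ^+ i * xi ^+ j) by rewrite /zeta !fexpE.
split=> [[|[|i]] j | i [|[|j]]] // _; rewrite !zetaE !fexpE !fscaleE !fsubE.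
  by rewrite -[i.+2]add2n exprD -mulrA (U_quadratic _ kappa_quadratic) mulrA -exprS.
by rewrite -[j.+2]add2n exprD mulrCA (U_quadratic _ xi_quadratic) (mulrCA xi) -exprS.
Qed.
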